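(* Let $A\subset\mathbb N$ be an infinite set of positive integers, listed in increasing order as $\mathbf a=(a_n)_{n\ge1}$. Let $t_n=1$ if $n\in A$ and $t_n=0$ otherwise, and let $c_n=2t_n-1$ for $n\ge1$. Then $\mathbf c=(c_n)_{n\ge1}$ is an oscillating sequence if and only if $\mathbf a$ is uniformly behaved in $\mathbb N$ and $D(A)=\frac12$.
   Context: A sequence $(c_n)_{n\ge1}$ of complex numbers is an oscillating sequence if $\lim_{N\to\infty}\frac1N\sum_{n=1}^N c_ne^{2\pi i n\theta}=0$ for every real $0\le\theta<1$, and there are constants $\lambda>1$ and $C>0$ with $\frac1N\sum_{n=1}^N|c_n|^\lambda\le C$ for all $N\ge1$. $\mathbf a$ is uniformly behaved in $\mathbb N$ if for every real $0<\theta<1$, $\lim_{N\to\infty}\frac1N\sum_{n=1}^N e^{2\pi i a_n\theta}=0$. $D(A)=\lim_{N\to\infty}\frac{\#(A\cap[1,N])}{N}$ is the density of $A$; ''$D(A)=\frac12$'' means that this limit exists and equals $\frac12$. *)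

(* Defs.v *)
(* The complex numbers are R[i]; its alias R[i]^o carries the topology of the
   modulus. *)
From mathcomp Require Import all_boot all_order all_algebra.
From mathcomp Require Import finmap.
From mathcomp Require Import all_classical all_reals all_analysis.
From mathcomp Require Import complex.

Set Implicit Arguments.
Unset Strict Implicit.
Unset Printing Implicit Defensive.

Import Order.TTheory GRing.Theory Num.Theory.
Import numFieldNormedType.Exports.
Local Open Scope classical_set_scope.
Local Open Scope complex_scope.
Local Open Scope ring_scope.

(* A sequence (u_n)_{n >= 1} is a function on nat whose value at 0 is never
   used. *)

Definition mean (K : fieldType) (u : nat -> K) (N : nat) : K :=
  (\sum_(1 <= n < N.+1) u n) / N%:R.

(* exp (2 pi i x), written out since there is no complex exponential on R[i] *)
Definition e2pii (R : realType) (x : R) : R[i] :=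
  cos (2 * pi * x) +i* sin (2 * pi * x).

(* [normc] is the R-valued modulus; [0 `^ lambda = 0] as lambda <> 0. *)
Definition oscillating (R : realType) (c : nat -> R[i]) : Prop :=
  (forall theta : R, 0 <= theta < 1 ->
     mean (fun n => c n * e2pii (n%:R * theta)) N @[N --> \oo] --> (0 : R[i]^o))
  /\
  (exists lambda C : R, [/\ 1 < lambda, 0 < C &
     forall N : nat, (1 <= N)%N ->
       mean (fun n => ComplexField.Normc.normc (c n) `^ lambda) N <= C]).

Definition uniformly_behaved (R : realType) (a : nat -> nat) : Prop :=
  forall theta : R, 0 < theta < 1 ->
    mean (fun n => e2pii ((a n)%:R * theta)) N @[N --> \oo] --> (0 : R[i]^o).

Definition has_density (R : realType) (A : set nat) (d : R) : Prop :=
  (#|` fset_set (A `&` [set n | (1 <= n <= N)%N]) |)%:R / N%:R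
     @[N --> \oo] --> d.

Definition increasing_listing (A : set nat) (a : nat -> nat) : Prop :=
  (forall m n : nat, (1 <= m)%N -> (m < n)%N -> (a m < a n)%N) /\
  a @` [set n | (1 <= n)%N] = A.

(* Main.v *)
Require Import Defs.
From mathcomp Require Import all_boot all_order all_algebra.
From mathcomp Require Import finmap.
From mathcomp Require Import all_classical all_reals all_analysis.
From mathcomp Require Import complex.

Set Implicit Arguments.
Unset Strict Implicit.
Unset Printing Implicit Defensive.

Import Order.TTheory GRing.Theory Num.Theory.
Import numFieldNormedType.Exports.
Local Open Scope classical_set_scope.
Local Open Scope complex_scope.
Local Open Scope ring_scope.

(** Since [c = 2 t - 1], the mean of [c_n e(n theta)] is twice the mean of
    [t_n e(n theta)] minus the mean of [e(n theta)] ([mean_sign_cvg0]), where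
    [e(x) = exp (2 pi i x)].

    At [theta = 0] the exponentials have mean 1, so the oscillation condition
    says exactly that the mean of [t], that is the proportion of elements of
    [A] up to [N], tends to [1/2].

    At [0 < theta < 1] the exponentials form a geometric progression of ratio
    different from 1, so their means tend to 0 ([mean_e2pii_cvg0]) and the
    condition says that the mean of [t_n e(n theta)] tends to 0. The sum of
    [t_n e(n theta)] for [n <= N] is the sum of [e(a_j theta)] for [j <= k],
    where [k] counts the elements of [A] up to [N] ([sum_indic_listing]). Hence
    the mean of [t_n e(n theta)] up to [N] is [k / N] times the mean of
    [e(a_j theta)] up to [k]. Once [k / N] tends to [1/2], which is nonzero,
    one of these means tends to 0 if and only if the other does
    ([mean_indic_cvg0]).

    The growth condition on [c] holds because its values are signs. *)

(** * Limits of real and complex sequences *)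

(** A positive element of [R[i]] is a positive real, so both topologies are
    tested with the same radii. *)
Lemma cvg_real_complex (R : realType) (u : nat -> R) (l : R) :
  (u N)%:C @[N --> \oo] --> (l%:C : R[i]^o) <-> u N @[N --> \oo] --> l.
Proof.
have dist x : `|l%:C - x%:C| = `|l - x|%:C :> R[i].
  by rewrite -rmorphB normc_def /= expr0n addr0 sqrtr_sqr.
split=> cvg_u.
- apply/(@cvgrPdist_lt _ R^o) => eps eps_gt0.
  have {}cvg_u := iffLR (@cvgrPdist_lt R[i] R[i]^o _ \oo eventually_filter _ _)
    cvg_u.
  have /cvg_u : (0 : R[i]) < eps%:C by rewrite ltcR.
  by apply: filterS => N; rewrite dist ltcR.
- apply/(@cvgrPdist_lt _ R[i]^o) => eps eps_gt0.
  have {}cvg_u := iffLR (@cvgrPdist_lt R R^o _ \oo eventually_filter _ _) cvg_u.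
  case: eps eps_gt0 => e f.
  rewrite ltcE /= => /andP[/eqP -> e_gt0].
  by have := cvg_u _ e_gt0; apply: filterS => N; rewrite dist ltcR.
Qed.

(** * The complex exponential *)

Lemma e2piiD (R : realType) (x y : R) :
  e2pii (x + y) = e2pii x * e2pii y.
Proof.
rewrite /e2pii mulrDr cosD sinD; apply/eqP; rewrite eq_complex /=.
by rewrite eqxx addrC eqxx.
Qed.

Lemma e2pii0 (R : realType) : e2pii (0 : R) = 1.
Proof. by rewrite /e2pii mulr0 cos0 sin0. Qed.

Lemma e2piiMn (R : realType) (n : nat) (x : R) :
  e2pii (n%:R * x) = e2pii x ^+ n.
Proof.
elim: n => [|n IHn]; first by rewrite mul0r e2pii0.
by rewrite -natr1 mulrDl mul1r e2piiD IHn exprSr.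
Qed.

Lemma norm_e2pii (R : realType) (x : R) : `|e2pii x| = 1.
Proof. by rewrite normc_def /= cos2Dsin2 sqrtr1. Qed.

(** The real part is [1 - 2 sin (pi x) ^ 2], and [sin] is positive on
    [(0, pi)]. *)
Lemma e2pii_neq1 (R : realType) (x : R) : 0 < x < 1 -> e2pii x != 1.
Proof.
move=> /andP[x_gt0 x_lt1]; rewrite eq_complex /= negb_and.
apply/orP; left.
have sin_gt0 : 0 < sin (pi * x).
  apply: sin_gt0_pi; rewrite mulr_gt0 ?pi_gt0 //=.
  by rewrite -[ltRHS]mulr1 ltr_pM2l ?pi_gt0.
rewrite -mulrA mulr_natl cos_mulr2n cos2sin2 lt_eqF // ltrBlDr -mulr2n.
by rewrite ltr_pMn2r // ltrBlDr ltrDl exprn_gt0.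
Qed.

Lemma invr_nat_cvg0 (R : realType) : N%:R^-1 @[N --> \oo] --> (0 : R[i]^o).
Proof.
have inv_nat : (N%:R^-1 : R) @[N --> \oo] --> (0 : R).
  by rewrite -cvg_shiftS; exact: cvg_harmonic.
have /(iffRL (cvg_real_complex _ _)) := inv_nat.
by under eq_cvg do rewrite fmorphV rmorph_nat.
Qed.

Lemma cvg0_le_inv_nat (R : realType) (u : nat -> R[i]) (C : R[i]) :
  (forall N, `|u N| <= C / N%:R) -> u N @[N --> \oo] --> (0 : R[i]^o).
Proof.
move=> u_le; apply/(@cvgrPdist_lt _ R[i]^o) => eps eps_gt0.
have C_cvg : C / N%:R @[N --> \oo] --> (0 : R[i]^o).
  by rewrite -(mulr0 C); apply: (@cvgMl_tmp R[i]); exact: invr_nat_cvg0.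
have := iffLR (@cvgrPdist_lt R[i] R[i]^o _ \oo eventually_filter _ _)
  C_cvg _ eps_gt0.
apply: filterS => N; rewrite !sub0r !normrN; apply: le_lt_trans.
by rewrite (ger0_norm (le_trans _ (u_le N))).
Qed.

(** The geometric sum is at most [2 / |z - 1|] in modulus, uniformly in [N]. *)
Lemma mean_e2pii_cvg0 (R : realType) (theta : R) : 0 < theta < 1 ->
  mean (fun n => e2pii (n%:R * theta)) N @[N --> \oo] --> (0 : R[i]^o).
Proof.
move=> /e2pii_neq1; set z := e2pii theta => z_neq1.
have sumE N : \sum_(1 <= n < N.+1) e2pii (n%:R * theta)
    = (z ^+ N.+1 - z) / (z - 1).
  apply: (canRL (mulfK _)); first by rewrite subr_eq0.
  rewrite -[z in RHS]expr1 -(telescope_sumr (fun n => z ^+ n)) //.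
  rewrite mulr_suml; apply: eq_bigr => n _.
  by rewrite e2piiMn mulrBr mulr1 exprSr.
have bound N : `|mean (fun n => e2pii (n%:R * theta)) N|
    <= 2 / `|z - 1| / N%:R :> R[i].
  rewrite /mean sumE !normrM !normfV normr_nat ler_wpM2r ?invr_ge0 //.
  rewrite ler_wpM2r ?invr_ge0 //.
  by rewrite (le_trans (ler_normB _ _)) // normrX norm_e2pii expr1n.
exact: cvg0_le_inv_nat bound.
Qed.

(** * Means weighted by [2 t - 1] *)

Lemma mean1_cvg1 (K : numFieldType) :
  mean (fun=> 1) N @[N --> \oo] --> (1 : K).
Proof.
apply: cvg_near_cst; near=> N.
have N_gt0 : (0 < N)%N by near: N; exact: nbhs_infty_ge.
rewrite /mean big_const_nat iter_addr_0 subn1 /= mulfV //.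
by rewrite pnatr_eq0 -lt0n.
Unshelve. all: by end_near. Qed.

(** The mean of [(2 t - 1) F] is twice the mean of [t F] minus the mean of [F],
    and the latter has a limit. *)
Lemma mean_sign_cvg0 (K : numFieldType) (t F : nat -> K) (l : K) :
  mean F N @[N --> \oo] --> l ->
  mean (fun n => (2 * t n - 1) * F n) N @[N --> \oo] --> (0 : K) <->
  mean (fun n => t n * F n) N @[N --> \oo] --> l / 2.
Proof.
move=> F_cvg.
have meanE N : mean (fun n => (2 * t n - 1) * F n) N
    = 2 * mean (fun n => t n * F n) N - mean F N.
  rewrite /mean mulrA -mulrBl mulr_sumr -sumrB; congr (_ / _).
  by apply: eq_bigr => n _; rewrite mulrBl mul1r mulrA.
have two_neq0 : (2 : K) != 0 by rewrite pnatr_eq0.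
split=> [sign_cvg|t_cvg].
- have -> : l / 2 = (0 + l) / 2 by rewrite add0r.
  have -> : mean (fun n => t n * F n)
      = (fun N => (mean (fun n => (2 * t n - 1) * F n) N + mean F N) / 2).
    by apply/funext => N; rewrite meanE subrK mulrC mulKf.
  exact: cvgMr_tmp (cvgD sign_cvg F_cvg).
- have -> : 0 = 2 * (l / 2) - l :> K by rewrite mulrC divfK ?subrr.
  have -> : mean (fun n => (2 * t n - 1) * F n)
      = (fun N => 2 * mean (fun n => t n * F n) N - mean F N).
    exact/funext.
  exact: cvgB (cvgMl_tmp t_cvg) F_cvg.
Qed.

(** * The counting function of a set of integers *)

Definition counting (A : set nat) (N : nat) : nat :=
  \sum_(1 <= n < N.+1) (n \in A).

Lemma countingS (A : set nat) (N : nat) :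
  counting A N.+1 = (counting A N + (N.+1 \in A))%N.
Proof. by rewrite /counting big_nat_recr. Qed.

Lemma counting0 (A : set nat) : counting A 0 = 0%N.
Proof. by rewrite /counting big_geq. Qed.

Lemma card_counting (A : set nat) (N : nat) :
  #|` fset_set (A `&` [set n | (1 <= n <= N)%N])| = counting A N.
Proof.
have -> : A `&` [set n | (1 <= n <= N)%N]
    = [set` [fset n | n in [seq n <- index_iota 1 N.+1 | n \in A]]%fset].
  apply/seteqP; split=> n /=.
    by move=> [/mem_set nA n_le]; rewrite !inE mem_filter mem_index_iota nA.
  by rewrite !inE mem_filter mem_index_iota => /andP[/set_mem].
rewrite set_fsetK card_fseq undup_id; last exact/filter_uniq/iota_uniq.
rewrite size_filter -sum1_count big_mkcond.
by apply: eq_bigr => n _; case: (n \in A).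
Qed.

Lemma mean_indic (K : numFieldType) (A : set nat) (N : nat) :
  mean (\1_A : nat -> K) N = (counting A N)%:R / N%:R.
Proof. by rewrite /mean /counting natr_sum. Qed.

(** Complex values let the density enter products with means of exponentials. *)
Lemma has_density_counting (R : realType) (A : set nat) :
  has_density A (2^-1 : R) <->
  (counting A N)%:R / N%:R @[N --> \oo] --> (2^-1 : R[i]^o).
Proof.
have -> : (2^-1 : R[i]) = (2^-1 : R)%:C by rewrite fmorphV rmorph_nat.
rewrite /has_density -cvg_real_complex.
have -> // : (fun N =>
    (#|` fset_set (A `&` [set n | (1 <= n <= N)%N])|%:R / N%:R : R)%:C)
  = (fun N => (counting A N)%:R / N%:R).
by apply/funext => N; rewrite card_counting fmorph_div !rmorph_nat.
Qed.

(** * Passing from a set to its increasing listing *)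

Section Listing.
Variables (A : set nat) (a : nat -> nat).
Hypotheses (Apos : A `<=` [set n | (1 <= n)%N]) (aA : increasing_listing A a).

Lemma listing_mono j k :
  (1 <= j)%N -> (1 <= k)%N -> (a j <= a k)%N = (j <= k)%N.
Proof.
move=> j_gt0 k_gt0; case: (ltngtP j k) => [j_lt_k | k_lt_j | ->].
- by rewrite ltnW ?aA.1.
- by apply/negbTE; rewrite -ltnNge aA.1.
- exact: leqnn.
Qed.

Lemma mem_listing j : (1 <= j)%N -> A (a j).
Proof. by rewrite -aA.2; exists j. Qed.

(** The listing and the counting function are adjoint; both limits and the
    identity [counting A (a m) = m] below follow from this. If [N + 1] is in
    [A], its index is [counting A N + 1]: the entries of smaller index are at
    most [N], and if its index were larger, the entry of index
    [counting A N + 1] would be at most [N] as well. *)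
Lemma listing_le_counting N j :
  (1 <= j)%N -> (a j <= N)%N = (j <= counting A N)%N.
Proof.
elim: N j => [|N IHN] j j_gt0.
  by rewrite counting0 !leqn0 !gtn_eqF //; exact: Apos (mem_listing j_gt0).
rewrite countingS; case: (boolP (N.+1 \in A)) => [/set_mem|] NA.
  have [i /= i_gt0 ai] : (a @` [set n | (1 <= n)%N]) N.+1 by rewrite aA.2.
  suff -> : (counting A N + true)%N = i by rewrite -ai listing_mono.
  apply/eqP; rewrite addn1 eqn_leq; apply/andP; split.
    by rewrite ltnNge -IHN // ai ltnn.
  rewrite leqNgt; apply/negP => /(aA.1 _ _ (ltn0Sn _)).
  by rewrite ai ltnS IHN // ltnn.
rewrite addn0 -IHN // leq_eqVlt ltnS orb_idl // => /eqP aj.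
by case/negP: NA; rewrite -aj; apply/mem_set/mem_listing.
Qed.

Lemma counting_listing m : (1 <= m)%N -> counting A (a m) = m.
Proof.
move=> m_gt0; apply/eqP; rewrite eqn_leq -listing_le_counting // leqnn andbT.
by rewrite leqNgt -listing_le_counting // -ltnNge aA.1.
Qed.

Lemma counting_cvg : counting A N @[N --> \oo] --> \oo.
Proof.
apply/cvgnyPgt => M; near=> N; rewrite -listing_le_counting //.
by near: N; exact: nbhs_infty_ge.
Unshelve. all: by end_near. Qed.

Lemma listing_cvg : a m @[m --> \oo] --> \oo.
Proof.
apply/cvgnyPgt => M; near=> m.
rewrite ltnNge listing_le_counting; last by near: m; exact: nbhs_infty_ge.
by rewrite -ltnNge; near: m; exact: nbhs_infty_gt.
Unshelve. all: by end_near. Qed.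

Lemma sum_indic_listing (K : pzRingType) (F : nat -> K) N :
  \sum_(1 <= n < N.+1) \1_A n * F n
  = \sum_(1 <= j < (counting A N).+1) F (a j).
Proof.
elim: N => [|N IHN]; first by rewrite counting0 !big_geq.
rewrite big_nat_recr //= {}IHN countingS indicE.
case: (boolP (N.+1 \in A)) => [/set_mem NA|_]; last first.
  by rewrite mul0r addr0 addn0.
have [i /= i_gt0 ai] : (a @` [set n | (1 <= n)%N]) N.+1 by rewrite aA.2.
have i_eq : i = (counting A N).+1.
  by rewrite -(counting_listing i_gt0) ai countingS (mem_set NA) addn1.
by rewrite mul1r addn1 [RHS]big_nat_recr //= -i_eq ai.
Qed.

(** With [k = counting A N], the [1 / k] inside the mean over the listing
    cancels the density factor [k / N]. For [k = 0] both sides vanish because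
    the sums are empty. *)
Lemma mean_indic_listing (K : numFieldType) (F : nat -> K) N :
  mean (fun n => \1_A n * F n) N
  = (counting A N)%:R / N%:R * mean (F \o a) (counting A N).
Proof.
rewrite /mean sum_indic_listing.
case: (counting A N) => [|k]; first by rewrite !big_geq // !mul0r.
by rewrite [RHS]mulrC -[RHS]mulrA mulKf ?pnatr_eq0.
Qed.

(** By [mean_indic_listing] the two means differ by the factor
    [counting A N / N], whose limit is invertible. Going from the listing to
    the set, [N] is replaced by [counting A N]; going back, the means over the
    set are sampled along the subsequence [N = a m], where
    [counting A N = m]. *)
Lemma mean_indic_cvg0 (K : numFieldType) (F : nat -> K) :
  (counting A N)%:R / N%:R @[N --> \oo] --> (2^-1 : K) ->
  mean (fun n => \1_A n * F n) N @[N --> \oo] --> (0 : K) <->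
  mean (F \o a) N @[N --> \oo] --> (0 : K).
Proof.
move=> dA; split=> [mean_cvg|mean_cvg].
- have subseq_cvg (u : nat -> K) (l : K) : u N @[N --> \oo] --> l ->
    u (a N) @[N --> \oo] --> l.
    by move=> u_cvg; exact: cvg_comp _ _ listing_cvg u_cvg.
  have half_neq0 : (2^-1 : K) != 0 by rewrite invr_eq0 pnatr_eq0.
  rewrite -(mul0r (2^-1 : K)^-1).
  apply: cvg_trans (cvgM (subseq_cvg _ _ mean_cvg)
    (cvgV half_neq0 (subseq_cvg _ _ dA))).
  apply: near_eq_cvg; near=> m.
  have m_gt0 : (0 < m)%N by near: m; exact: nbhs_infty_ge.
  have am_gt0 : (0 < a m)%N := Apos (mem_listing m_gt0).
  rewrite /= mean_indic_listing counting_listing // mulrC mulKf //.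
  by rewrite mulf_neq0 ?invr_eq0 ?pnatr_eq0 -?lt0n.
- rewrite -(mulr0 (2^-1 : K)).
  apply: cvg_trans (cvgM dA (cvg_comp _ _ counting_cvg mean_cvg)).
  apply: near_eq_cvg; near=> N.
  by rewrite mean_indic_listing.
Unshelve. all: by end_near. Qed.

End Listing.

(** * The characterization *)

Theorem theorem9 (R : realType) (A : set nat) (a : nat -> nat)
    (Apos : A `<=` [set n | (1 <= n)%N])
    (Ainf : infinite_set A)
    (aA : increasing_listing A a) :
  let t : nat -> R[i] := \1_A in
  let c : nat -> R[i] := fun n => 2 * t n - 1 in
  oscillating c <-> uniformly_behaved R a /\ has_density A (2^-1 : R).
Proof.
move=> t c.
(* The values of [c] are signs, so every exponent works. *)
have c_bound : exists lambda C : R, [/\ 1 < lambda, 0 < C &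
    forall N : nat, (1 <= N)%N ->
    mean (fun n => ComplexField.Normc.normc (c n) `^ lambda) N <= C].
  exists 2, 1; split; rewrite ?ltr1n // => N N_gt0.
  rewrite /mean (eq_bigr (fun=> 1)).
    by rewrite big_const_nat iter_addr_0 subn1 /= divff // pnatr_eq0 -lt0n.
  move=> n _; suff -> : ComplexField.Normc.normc (c n) = 1 by rewrite powR1.
  rewrite /c /t indicE; case: (n \in A).
    by rewrite mulr1 mulr2n addrK ComplexField.Normc.normc1.
  by rewrite mulr0 sub0r normcN ComplexField.Normc.normc1.
(* At frequency 0 the mean of [c] up to [N >= 1] is
   [2 counting A N / N - 1]. *)
have cvg_at0 : mean (fun n => c n * e2pii (n%:R * 0)) N @[N --> \oo]
    --> (0 : R[i]^o) <-> has_density A (2^-1 : R).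
  rewrite has_density_counting.
  have -> : (fun n => c n * e2pii (n%:R * 0)) = (fun n => c n * 1).
    by apply/funext => n; rewrite mulr0 e2pii0.
  rewrite (@mean_sign_cvg0 R[i] t _ 1 (@mean1_cvg1 R[i])) mul1r.
  have -> // : mean (fun n => t n * 1) = (fun N => (counting A N)%:R / N%:R).
  apply/funext => N; rewrite -mean_indic /mean; congr (_ / _).
  by apply: eq_bigr => n _; rewrite mulr1.
(* At other frequencies the exponentials have mean 0, so the constant term -1
   of [c] does not contribute. *)
have cvg_at theta : has_density A (2^-1 : R) -> 0 < theta < 1 ->
    mean (fun n => c n * e2pii (n%:R * theta)) N @[N --> \oo]
      --> (0 : R[i]^o) <->
    mean (fun n => e2pii ((a n)%:R * theta)) N @[N --> \oo] --> (0 : R[i]^o).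
  move=> /has_density_counting dA /mean_e2pii_cvg0 e_cvg.
  rewrite (@mean_sign_cvg0 R[i] t _ 0 e_cvg) mul0r.
  exact: (@mean_indic_cvg0 A a Apos aA R[i] _ dA).
split=> [[c_cvg _]|[a_cvg dA]].
- have dA : has_density A (2^-1 : R) by apply/cvg_at0/c_cvg; rewrite lexx ltr01.
  split=> // theta /[dup] theta01 /andP[theta_gt0 theta_lt1].
  by apply/(cvg_at _ dA theta01)/c_cvg; rewrite ltW.
- split=> // theta /andP[]; rewrite le_eqVlt.
  move=> /predU1P[<- _|theta_gt0 theta_lt1]; first exact/cvg_at0.
  have theta01 : 0 < theta < 1 by rewrite theta_gt0.
  exact/(cvg_at _ dA theta01)/a_cvg.
Qed.
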